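(* (Subformula Property) In the Fitch-style calculus for $IK$: if $\Gamma\vdash t:A$ is derivable and $t$ is normal, then every subterm of $t$ has, as its type in the derivation tree, a subformula of $A$ or a subformula of some type assigned to a variable in $\Gamma$.
   Context: Types: $A,B ::= p \mid 1 \mid A\times B \mid A\to B \mid 0 \mid A+B \mid \Box A$ ($p$ atoms). Contexts: $\Gamma ::= \cdot \mid \Gamma,x:A \mid \Gamma,\bullet$ (variables distinct; $\bullet$ is a structural symbol called a lock). Terms: $x$, $\langle\rangle$, $\langle t,u\rangle$, $\pi_1 t$, $\pi_2 t$, $\lambda x.t$, $t\,u$, $\mathrm{inl}\,t$, $\mathrm{inr}\,t$, $\mathrm{case}\ s\ \mathrm{of}\ (x.t;\,y.u)$, $\mathrm{abort}\,t$, $\mathrm{shut}\,t$, $\mathrm{open}\,t$. Typing rules: (var) $\Gamma,x:A,\Gamma'\vdash x:A$ provided $\Gamma'$ contains no lock; (products) $\Gamma\vdash\langle\rangle:1$; from $\Gamma\vdash t:A$, $\Gamma\vdash u:B$ infer $\Gamma\vdash\langle t,u\rangle:A\times B$; from $\Gamma\vdash t:A_1\times A_2$ infer $\Gamma\vdash\pi_i t:A_i$; (functions) from $\Gamma,x:A\vdash t:B$ infer $\Gamma\vdash\lambda x.t:A\to B$; from $\Gamma\vdash t:A\to B$, $\Gamma\vdash u:A$ infer $\Gamma\vdash t\,u:B$; (sums) from $\Gamma\vdash t:A$ infer $\Gamma\vdash\mathrm{inl}\,t:A+B$; symmetrically for $\mathrm{inr}$; from $\Gamma\vdash s:A+B$,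 $\Gamma,x:A,\Gamma'\vdash t:C$, $\Gamma,y:B,\Gamma'\vdash u:C$ infer $\Gamma,\Gamma'\vdash\mathrm{case}\ s\ \mathrm{of}\ (x.t;\,y.u):C$ (any $\Gamma'$); from $\Gamma\vdash t:0$ infer $\Gamma,\Gamma'\vdash\mathrm{abort}\,t:A$ (any $\Gamma'$); (shut) from $\Gamma,\bullet\vdash t:A$ infer $\Gamma\vdash\mathrm{shut}\,t:\Box A$; (open) from $\Gamma\vdash t:\Box A$ infer $\Gamma,\bullet,\Gamma'\vdash\mathrm{open}\,t:A$ provided $\Gamma'$ contains no lock. Reduction: $\mapsto$ is the closure under all term formers of $(\lambda x.t)\,u\mapsto t[u/x]$; $\pi_i\langle t_1,t_2\rangle\mapsto t_i$; $\mathrm{case}\ (\mathrm{inl}\,s)\ \mathrm{of}\ (x.t;\,y.u)\mapsto t[s/x]$; $\mathrm{case}\ (\mathrm{inr}\,s)\ \mathrm{of}\ (x.t;\,y.u)\mapsto u[s/y]$; $\mathrm{open}\,\mathrm{shut}\,t\mapsto t$; and the commuting conversions $E[\mathrm{case}\ s\ \mathrm{of}\ (x.t;\,y.u)]\mapsto\mathrm{case}\ s\ \mathrm{of}\ (x.E[t];\,y.E[u])$ and $E[\mathrm{abort}\,t]\mapsto\mathrm{abort}\,t$ for every elimination frame $E[-]$ among $[-]\,v$, $\pi_1[-]$, $\pi_2[-]$, $\mathrm{case}\ [-]\ \mathrm{of}\ (\ldots)$, $\mathrm{abort}[-]$, $\mathrm{open}[-]$. A term is normal if it admits no reduction step. Subformulas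 of a type are defined as usual (e.g. the subformulas of $\Box A$ are $\Box A$ and the subformulas of $A$). *)

(* Defs.v *)
From Stdlib Require Import List Arith.
Import ListNotations.
Set Implicit Arguments.

Inductive ty (P : Type) : Type :=
| Atom (p : P)
| One
| Prod (A B : ty P)
| Arr (A B : ty P)
| Zero
| Sum (A B : ty P)
| Box (A : ty P).

Arguments One {P}.
Arguments Zero {P}.

Inductive subformula (P : Type) (C : ty P) : ty P -> Prop :=
| sf_refl : subformula C C
| sf_prod1 A B : subformula C A -> subformula C (Prod A B)
| sf_prod2 A B : subformula C B -> subformula C (Prod A B)
| sf_arr1 A B : subformula C A -> subformula C (Arr A B)
| sf_arr2 A B : subformula C B -> subformula C (Arr A B)
| sf_sum1 A B : subformula C A -> subformula C (Sum A B)
| sf_sum2 A B : subformula C B -> subformula C (Sum A B)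
| sf_box A : subformula C A -> subformula C (Box A).

(** Terms are locally nameless: free variables are names, drawn from [nat],
    and bound variables are de Bruijn indices. [tm_lam t] binds index 0 of [t];
    [tm_case s t u] stands for [case s of (x.t; y.u)] and binds index 0 of [t]
    and, separately, index 0 of [u]. Terms up to alpha-conversion are the
    elements of [tm] without dangling index; only these are typable. *)
Inductive tm : Type :=
| tm_bvar (i : nat)
| tm_fvar (x : nat)
| tm_unit
| tm_pair (t u : tm)
| tm_proj1 (t : tm)
| tm_proj2 (t : tm)
| tm_lam (t : tm)
| tm_app (t u : tm)
| tm_inl (t : tm)
| tm_inr (t : tm)
| tm_case (s t u : tm)
| tm_abort (t : tm)
| tm_shut (t : tm)
| tm_open (t : tm).

Fixpoint fv (t : tm) : list nat :=
  match t with
  | tm_bvar _ | tm_unit => []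
  | tm_fvar x => [x]
  | tm_pair t u | tm_app t u => fv t ++ fv u
  | tm_case s t u => fv s ++ fv t ++ fv u
  | tm_proj1 t | tm_proj2 t | tm_lam t | tm_inl t | tm_inr t | tm_abort t | tm_shut t | tm_open t => fv t
  end.

(** [inst_at k v t] replaces the bound index [k] of [t] by [v]. When [v] has no
    dangling index it needs no lifting below binders, and no capture can
    occur: [inst v t] is then the substitution [t[v/x]] in the body [t] of a
    binder for [x]. *)
Fixpoint inst_at (k : nat) (v t : tm) : tm :=
  match t with
  | tm_bvar i => if Nat.eqb i k then v else tm_bvar i
  | tm_fvar x => tm_fvar x
  | tm_unit => tm_unit
  | tm_pair t u => tm_pair (inst_at k v t) (inst_at k v u)
  | tm_proj1 t => tm_proj1 (inst_at k v t)
  | tm_proj2 t => tm_proj2 (inst_at k v t)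
  | tm_lam t => tm_lam (inst_at (S k) v t)
  | tm_app t u => tm_app (inst_at k v t) (inst_at k v u)
  | tm_inl t => tm_inl (inst_at k v t)
  | tm_inr t => tm_inr (inst_at k v t)
  | tm_case s t u =>
      tm_case (inst_at k v s) (inst_at (S k) v t) (inst_at (S k) v u)
  | tm_abort t => tm_abort (inst_at k v t)
  | tm_shut t => tm_shut (inst_at k v t)
  | tm_open t => tm_open (inst_at k v t)
  end.

Definition inst (v t : tm) : tm := inst_at 0 v t.

Inductive entry (P : Type) : Type :=
| hyp (x : nat) (A : ty P)
| lock.

Arguments lock {P}.

(** The most recent entry comes first: [Γ, x:A, Γ'] is [Γ' ++ hyp x A :: Γ]. *)
Definition ctx (P : Type) : Type := list (entry P).

Definition lockfree (P : Type) (Γ : ctx P) : Prop := ~ In lock Γ.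

Fixpoint dom (P : Type) (Γ : ctx P) : list nat :=
  match Γ with
  | [] => []
  | hyp x _ :: Γ => x :: dom Γ
  | lock :: Γ => dom Γ
  end.

Definition distinct (P : Type) (Γ : ctx P) : Prop := NoDup (dom Γ).

(** Derivation trees; they live in [Type] because a term may have several
    derivations, with different types for its subterms. A rule for a binder
    names the bound variable by some [x] not free in the body. The
    [distinct] premises are placed so that every context occurring in a
    derivation has pairwise distinct variables (see [deriv_distinct]). *)
Inductive deriv (P : Type) : ctx P -> tm -> ty P -> Type :=
| d_var Γ Γ' x A :
    distinct (Γ' ++ hyp x A :: Γ) -> lockfree Γ' ->
    deriv (Γ' ++ hyp x A :: Γ) (tm_fvar x) A
| d_unit Γ :
    distinct Γ ->
    deriv Γ tm_unit One
| d_pair Γ t u A B :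
    deriv Γ t A -> deriv Γ u B ->
    deriv Γ (tm_pair t u) (Prod A B)
| d_proj1 Γ t A B :
    deriv Γ t (Prod A B) ->
    deriv Γ (tm_proj1 t) A
| d_proj2 Γ t A B :
    deriv Γ t (Prod A B) ->
    deriv Γ (tm_proj2 t) B
| d_lam Γ x t A B :
    ~ In x (fv t) ->
    deriv (hyp x A :: Γ) (inst (tm_fvar x) t) B ->
    deriv Γ (tm_lam t) (Arr A B)
| d_app Γ t u A B :
    deriv Γ t (Arr A B) -> deriv Γ u A ->
    deriv Γ (tm_app t u) B
| d_inl Γ t A B :
    deriv Γ t A ->
    deriv Γ (tm_inl t) (Sum A B)
| d_inr Γ t A B :
    deriv Γ t B ->
    deriv Γ (tm_inr t) (Sum A B)
| d_case Γ Γ' s x t y u A B C :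
    ~ In x (fv t) -> ~ In y (fv u) ->
    deriv Γ s (Sum A B) ->
    deriv (Γ' ++ hyp x A :: Γ) (inst (tm_fvar x) t) C ->
    deriv (Γ' ++ hyp y B :: Γ) (inst (tm_fvar y) u) C ->
    deriv (Γ' ++ Γ) (tm_case s t u) C
| d_abort Γ Γ' t A :
    distinct (Γ' ++ Γ) ->
    deriv Γ t Zero ->
    deriv (Γ' ++ Γ) (tm_abort t) A
| d_shut Γ t A :
    deriv (lock :: Γ) t A ->
    deriv Γ (tm_shut t) (Box A)
| d_open Γ Γ' t A :
    distinct (Γ' ++ lock :: Γ) -> lockfree Γ' ->
    deriv Γ t (Box A) ->
    deriv (Γ' ++ lock :: Γ) (tm_open t) A.

Lemma dom_app (P : Type) (Γ Δ : ctx P) : dom (Γ ++ Δ) = dom Γ ++ dom Δ.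
Proof. induction Γ as [|[x A|] Γ IH]; simpl; congruence. Qed.

Lemma deriv_distinct (P : Type) (Γ : ctx P) t A : deriv Γ t A -> distinct Γ.
Proof.
  unfold distinct; induction 1; simpl in *; auto.
  - now inversion IHX.
  - rewrite dom_app in *; simpl in *. now apply NoDup_remove_1 in IHX2.
Qed.

(** The subterm occurrences of [t], each with the type it has in the derivation
    of [t]. The rules being syntax-directed, the nodes of the derivation are
    exactly these occurrences; in a subterm below a binder the bound variable
    appears under the name that the derivation gives it. *)
Fixpoint typed_subterms (P : Type) (Γ : ctx P) (t : tm) (A : ty P)
    (d : deriv Γ t A) {struct d} : list (tm * ty P) :=
  (t, A) ::
  match d with
  | @d_var _ _ _ _ _ _ _ => []
  | @d_unit _ _ _ => []
  | @d_pair _ _ _ _ _ _ d1 d2 => typed_subterms d1 ++ typed_subterms d2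
  | @d_proj1 _ _ _ _ _ d1 => typed_subterms d1
  | @d_proj2 _ _ _ _ _ d1 => typed_subterms d1
  | @d_lam _ _ _ _ _ _ _ d1 => typed_subterms d1
  | @d_app _ _ _ _ _ _ d1 d2 => typed_subterms d1 ++ typed_subterms d2
  | @d_inl _ _ _ _ _ d1 => typed_subterms d1
  | @d_inr _ _ _ _ _ d1 => typed_subterms d1
  | @d_case _ _ _ _ _ _ _ _ _ _ _ _ _ d1 d2 d3 =>
      typed_subterms d1 ++ typed_subterms d2 ++ typed_subterms d3
  | @d_abort _ _ _ _ _ _ d1 => typed_subterms d1
  | @d_shut _ _ _ _ d1 => typed_subterms d1
  | @d_open _ _ _ _ _ _ _ d1 => typed_subterms d1
  end.

Inductive frame : Type :=
| f_app (v : tm)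
| f_proj1
| f_proj2
| f_case (t u : tm)
| f_abort
| f_open.

Definition plug (E : frame) (t : tm) : tm :=
  match E with
  | f_app v => tm_app t v
  | f_proj1 => tm_proj1 t
  | f_proj2 => tm_proj2 t
  | f_case t' u' => tm_case t t' u'
  | f_abort => tm_abort t
  | f_open => tm_open t
  end.

(** One-step reduction, meant for terms without dangling index. For these,
    moving a frame below a binder in [st_comm_case] requires no lifting.
    Reduction below a binder names the bound variable by some fresh [x]. *)
Inductive step : tm -> tm -> Prop :=
| st_beta t u : step (tm_app (tm_lam t) u) (inst u t)
| st_proj1 t u : step (tm_proj1 (tm_pair t u)) t
| st_proj2 t u : step (tm_proj2 (tm_pair t u)) u
| st_case_inl s t u : step (tm_case (tm_inl s) t u) (inst s t)
| st_case_inr s t u : step (tm_case (tm_inr s) t u) (inst s u)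
| st_open_shut t : step (tm_open (tm_shut t)) t
| st_comm_case E s t u :
    step (plug E (tm_case s t u)) (tm_case s (plug E t) (plug E u))
| st_comm_abort E t : step (plug E (tm_abort t)) (tm_abort t)
| st_in_pair1 t t' u : step t t' -> step (tm_pair t u) (tm_pair t' u)
| st_in_pair2 t u u' : step u u' -> step (tm_pair t u) (tm_pair t u')
| st_in_proj1 t t' : step t t' -> step (tm_proj1 t) (tm_proj1 t')
| st_in_proj2 t t' : step t t' -> step (tm_proj2 t) (tm_proj2 t')
| st_in_lam x t t' :
    ~ In x (fv t) -> ~ In x (fv t') ->
    step (inst (tm_fvar x) t) (inst (tm_fvar x) t') -> step (tm_lam t) (tm_lam t')
| st_in_app1 t t' u : step t t' -> step (tm_app t u) (tm_app t' u)
| st_in_app2 t u u' : step u u' -> step (tm_app t u) (tm_app t u')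
| st_in_inl t t' : step t t' -> step (tm_inl t) (tm_inl t')
| st_in_inr t t' : step t t' -> step (tm_inr t) (tm_inr t')
| st_in_case s s' t u : step s s' -> step (tm_case s t u) (tm_case s' t u)
| st_in_case1 x s t t' u :
    ~ In x (fv t) -> ~ In x (fv t') ->
    step (inst (tm_fvar x) t) (inst (tm_fvar x) t') ->
    step (tm_case s t u) (tm_case s t' u)
| st_in_case2 x s t u u' :
    ~ In x (fv u) -> ~ In x (fv u') ->
    step (inst (tm_fvar x) u) (inst (tm_fvar x) u') ->
    step (tm_case s t u) (tm_case s t u')
| st_in_abort t t' : step t t' -> step (tm_abort t) (tm_abort t')
| st_in_shut t t' : step t t' -> step (tm_shut t) (tm_shut t')
| st_in_open t t' : step t t' -> step (tm_open t) (tm_open t').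

Definition normal (t : tm) : Prop := forall t', ~ step t t'.

(* Main.v *)
Require Import Defs.
From Stdlib Require Import List.
From Stdlib Require Import Arith Lia.

(** In a normal term the subject of an elimination is neither an introduction
    (a redex) nor a case or abort (a commuting conversion), so it is again an
    elimination or a variable.  Following subjects down to the head variable,
    the type of such a term is a subformula of a context type.  In particular
    the types introduced by the branches of a case, and the argument types of
    applications, stay within the subformulas of the context. *)

(** * Local closure, and its preservation by reduction *)

Fixpoint lc_at (k : nat) (t : tm) : Prop :=
  match t with
  | tm_bvar i => i < k
  | tm_fvar _ | tm_unit => True
  | tm_pair t u | tm_app t u => lc_at k t /\ lc_at k u
  | tm_case s t u => lc_at k s /\ lc_at (S k) t /\ lc_at (S k) u
  | tm_lam t => lc_at (S k) t
  | tm_proj1 t | tm_proj2 t | tm_inl t | tm_inr t | tm_abort t | tm_shut t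
  | tm_open t => lc_at k t
  end.

(** Left inverse-style companion of opening by [tm_fvar x]: it turns a reduct of an opened body back
    into a body, as the congruence rules under binders require. *)
Fixpoint close_at (k x : nat) (t : tm) : tm :=
  match t with
  | tm_bvar i => tm_bvar i
  | tm_fvar y => if Nat.eqb y x then tm_bvar k else tm_fvar y
  | tm_unit => tm_unit
  | tm_pair t u => tm_pair (close_at k x t) (close_at k x u)
  | tm_proj1 t => tm_proj1 (close_at k x t)
  | tm_proj2 t => tm_proj2 (close_at k x t)
  | tm_lam t => tm_lam (close_at (S k) x t)
  | tm_app t u => tm_app (close_at k x t) (close_at k x u)
  | tm_inl t => tm_inl (close_at k x t)
  | tm_inr t => tm_inr (close_at k x t)
  | tm_case s t u =>
      tm_case (close_at k x s) (close_at (S k) x t) (close_at (S k) x u)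
  | tm_abort t => tm_abort (close_at k x t)
  | tm_shut t => tm_shut (close_at k x t)
  | tm_open t => tm_open (close_at k x t)
  end.

Lemma fv_close_at (x : nat) (t : tm) (k : nat) : ~ In x (fv (close_at k x t)).
Proof.
  revert k; induction t; intros k; simpl; rewrite ?in_app_iff; firstorder.
  destruct (Nat.eqb_spec x0 x); simpl; tauto.
Qed.

(** Local closure at [k] excludes an index [k] already present in [t], which opening would confuse
    with the abstracted name. *)
Lemma inst_at_close_at (x : nat) (t : tm) (k : nat) :
  lc_at k t -> inst_at k (tm_fvar x) (close_at k x t) = t.
Proof.
  revert k; induction t; intros k H; simpl in *; try (f_equal; firstorder; fail).
  - destruct (Nat.eqb_spec i k); [lia | reflexivity].
  - destruct (Nat.eqb_spec x0 x); simpl; [rewrite Nat.eqb_refl|]; congruence.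
Qed.

Lemma lc_at_weaken (t : tm) (k l : nat) : k <= l -> lc_at k t -> lc_at l t.
Proof.
  revert k l; induction t; intros k l Hkl; simpl; intuition (try lia);
    match goal with
    | IH : forall k l, k <= l -> lc_at k ?t -> _, H : lc_at ?i ?t |- lc_at ?j ?t =>
        apply (IH i j); [lia | exact H]
    end.
Qed.

Lemma lc_at_inst_at (v t : tm) (k : nat) :
  lc_at 0 v -> lc_at (S k) t -> lc_at k (inst_at k v t).
Proof.
  intros Hv; revert k; induction t; intros k; simpl; try (firstorder; fail).
  destruct (Nat.eqb_spec i k); simpl; [|lia].
  intros _; apply (lc_at_weaken v 0); [lia | exact Hv].
Qed.

(** Instantiation changes only the index [k]; every other index of [t] survives in the instance,
    where it is bounded. *)
Lemma lc_at_inst_at_inv (v t : tm) (k : nat) :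
  lc_at k (inst_at k v t) -> lc_at (S k) t.
Proof.
  revert k; induction t; intros k; simpl; try (firstorder; fail).
  destruct (Nat.eqb_spec i k); simpl; lia.
Qed.

Lemma step_lc (t t' : tm) : step t t' -> lc_at 0 t -> lc_at 0 t'.
Proof.
  assert (Hup : forall u, lc_at 0 u -> lc_at 1 u)
    by (intros u; apply lc_at_weaken; lia).
  assert (Hinst : forall v u, lc_at 0 v -> lc_at 1 u -> lc_at 0 (inst v u))
    by (intros; now apply lc_at_inst_at).
  assert (Hbody : forall x u, lc_at 0 (inst (tm_fvar x) u) -> lc_at 1 u)
    by (intros x u; apply lc_at_inst_at_inv).
  induction 1; try destruct E; simpl in *; intuition eauto;
    try (eapply Hbody; apply IHstep; apply Hinst; simpl; auto; fail);
    (* In a commuting conversion with an [f_case] frame, the branches of the frame move below one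
       more binder, from level 1 to level 2. *)
    eapply lc_at_weaken; try eassumption; lia.
Qed.

Lemma deriv_lc (P : Type) (Γ : ctx P) (t : tm) (A : ty P) :
  deriv Γ t A -> lc_at 0 t.
Proof.
  induction 1; simpl; intuition; eapply lc_at_inst_at_inv; eassumption.
Qed.

(* A step of the opened body can be transported back under the binder by
   closing the reduct, which is possible since the reduct is locally closed. *)
Lemma step_inst_inv (x : nat) (t r : tm) :
  lc_at 0 (inst (tm_fvar x) t) -> step (inst (tm_fvar x) t) r ->
  exists t', ~ In x (fv t') /\ step (inst (tm_fvar x) t) (inst (tm_fvar x) t').
Proof.
  intros Hlc Hr; exists (close_at 0 x r); split; [apply fv_close_at|].
  unfold inst at 2; rewrite inst_at_close_at; [exact Hr|].
  exact (step_lc _ _ Hr Hlc).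
Qed.

(** Here [x] is the name chosen by the derivation, so normality is obtained for exactly the opened
    body that [d_lam] types. *)
Lemma normal_lam (x : nat) (t : tm) :
  ~ In x (fv t) -> lc_at 0 (inst (tm_fvar x) t) ->
  normal (tm_lam t) -> normal (inst (tm_fvar x) t).
Proof.
  intros Hx Hlc Hn r Hr; destruct (step_inst_inv _ _ _ Hlc Hr) as (t' & ? & ?).
  eapply Hn, st_in_lam; eassumption.
Qed.

Lemma normal_case1 (x : nat) (s t u : tm) :
  ~ In x (fv t) -> lc_at 0 (inst (tm_fvar x) t) ->
  normal (tm_case s t u) -> normal (inst (tm_fvar x) t).
Proof.
  intros Hx Hlc Hn r Hr; destruct (step_inst_inv _ _ _ Hlc Hr) as (t' & ? & ?).
  eapply Hn, st_in_case1; eassumption.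
Qed.

Lemma normal_case2 (x : nat) (s t u : tm) :
  ~ In x (fv u) -> lc_at 0 (inst (tm_fvar x) u) ->
  normal (tm_case s t u) -> normal (inst (tm_fvar x) u).
Proof.
  intros Hx Hlc Hn r Hr; destruct (step_inst_inv _ _ _ Hlc Hr) as (u' & ? & ?).
  eapply Hn, st_in_case2; eassumption.
Qed.

Lemma normal_plug (E : frame) (t : tm) : normal (plug E t) -> normal t.
Proof.
  intros Hn t' Ht; apply (Hn (plug E t')); destruct E; simpl; now constructor.
Qed.

(* Case and abort are excluded: their type is not tied to that of the subject. *)
Definition neutral (t : tm) : Prop :=
  match t with
  | tm_fvar _ | tm_proj1 _ | tm_proj2 _ | tm_app _ _ | tm_open _ => True
  | _ => False
  end.

Definition eliminates (P : Type) (E : frame) (A : ty P) : Prop :=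
  match E, A with
  | f_app _, Arr _ _ | f_proj1, Prod _ _ | f_proj2, Prod _ _
  | f_case _ _, Sum _ _ | f_abort, Zero | f_open, Box _ => True
  | _, _ => False
  end.

(** Typing forces an introduction in subject position to match the frame and so to form a redex; an
    ill-typed mismatch such as the projection of a lambda could be normal. *)
Lemma normal_plug_neutral (P : Type) (Γ : ctx P) (E : frame) (t : tm) (A : ty P) :
  deriv Γ t A -> eliminates P E A -> normal (plug E t) -> neutral t.
Proof.
  intros d HE Hn.
  destruct d; simpl; trivial; try (eapply Hn, st_comm_case);
    try (eapply Hn, st_comm_abort);
    destruct E; simpl in HE; try contradiction; eapply Hn; simpl; constructor.
Qed.

(** * Subformulas and types covered by a context *)

Lemma subformula_trans (P : Type) (A B C : ty P) :
  subformula A B -> subformula B C -> subformula A C.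
Proof. intros HAB; induction 1; auto using subformula. Qed.

Definition covered (P : Type) (Γ : ctx P) (B : ty P) : Prop :=
  exists (x : nat) (C : ty P), In (hyp x C) Γ /\ subformula B C.

Lemma covered_sub (P : Type) (Γ : ctx P) (A B : ty P) :
  covered P Γ B -> subformula A B -> covered P Γ A.
Proof.
  intros (x & C & HC & HB) HA; exists x, C; split; [exact HC|].
  exact (subformula_trans _ _ _ _ HA HB).
Qed.

Lemma covered_incl (P : Type) (Γ Δ : ctx P) (B : ty P) :
  (forall x C, In (hyp x C) Γ -> In (hyp x C) Δ) -> covered P Γ B -> covered P Δ B.
Proof. intros H (x & C & HC & HB); exists x, C; auto. Qed.

Lemma covered_hyp (P : Type) (Γ Γ' : ctx P) (x : nat) (A B : ty P) :
  covered P (Γ' ++ hyp x A :: Γ) B -> subformula B A \/ covered P (Γ' ++ Γ) B.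
Proof.
  intros (y & C & HC & HB); rewrite in_app_iff in HC; simpl in HC.
  destruct HC as [HC | [HC | HC]].
  - right; exists y, C; rewrite in_app_iff; auto.
  - injection HC as <- <-; auto.
  - right; exists y, C; rewrite in_app_iff; auto.
Qed.

Lemma covered_app_r (P : Type) (Γ Γ' : ctx P) (B : ty P) :
  covered P Γ B -> covered P (Γ' ++ Γ) B.
Proof. apply covered_incl; intros; apply in_or_app; auto. Qed.

(** Coverage ignores accessibility: hypotheses behind a lock still count, which is what [d_shut] and
    [d_open] need. *)
Lemma covered_lock (P : Type) (Γ : ctx P) (B : ty P) :
  covered P (lock :: Γ) B <-> covered P Γ B.
Proof.
  split; apply covered_incl; simpl; [intros x C [H|H]; [discriminate|]|]; auto.
Qed.

Definition within (P : Type) (Γ : ctx P) (A : ty P) (p : tm * ty P) : Prop :=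
  subformula (snd p) A \/ covered P Γ (snd p).

(** Carries the bound from a premise to the conclusion of a rule. The premise type, and the type of
    a variable bound by the rule, may be accounted for by either the new type or the new context. *)
Lemma within_mono (P : Type) (Γ Γ' : ctx P) (A A' : ty P) (l : list (tm * ty P)) :
  subformula A A' \/ covered P Γ' A ->
  (forall B, covered P Γ B -> subformula B A' \/ covered P Γ' B) ->
  Forall (within P Γ A) l -> Forall (within P Γ' A') l.
Proof.
  intros HA HΓ; apply Forall_impl; intros p [Hp | Hp]; [|exact (HΓ _ Hp)].
  destruct HA as [HA|HA]; [left | right].
  - exact (subformula_trans _ _ _ _ Hp HA).
  - exact (covered_sub _ _ _ _ HA Hp).
Qed.

Lemma within_root (P : Type) (Γ : ctx P) (t : tm) (A : ty P) (l : list (tm * ty P)) :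
  Forall (within P Γ A) l -> Forall (within P Γ A) ((t, A) :: l).
Proof. constructor; [left; constructor | assumption]. Qed.

(** The clause on neutral terms strengthens the induction: the type of an eliminated subject is in
    general no subformula of the result type, so the context must account for it. *)
Lemma normal_deriv_within (P : Type) (Γ : ctx P) (t : tm) (A : ty P)
    (d : deriv Γ t A) :
  normal t ->
  (neutral t -> covered P Γ A) /\ Forall (within P Γ A) (typed_subterms d).
Proof.
  (* One argument for the subjects of all six eliminations; [l] stands for the typed subterms of
     [e]. *)
  assert (Hsub : forall E Δ u T (e : deriv Δ u T) (l : list (tm * ty P)),
      (normal u -> (neutral u -> covered P Δ T) /\ Forall (within P Δ T) l) ->
      eliminates P E T -> normal (plug E u) ->
      covered P Δ T /\ Forall (within P Δ T) l).
  { intros E Δ u T e l IH HE Hn; destruct (IH (normal_plug _ _ Hn)) as [H1 H2].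
    split; [|exact H2]; apply H1; exact (normal_plug_neutral _ _ _ _ _ e HE Hn). }
  induction d; intros Hn; cbn [typed_subterms];
    (split; [try contradiction; intros _ | apply within_root]).
  - exists x, A; rewrite in_app_iff; simpl; split; [auto | constructor].
  - constructor.
  - constructor.
  - apply Forall_app; split.
    + destruct IHd1 as [_ H]; [intros t' Ht; eapply Hn, st_in_pair1, Ht|].
      eapply within_mono, H; auto using subformula.
    + destruct IHd2 as [_ H]; [intros t' Ht; eapply Hn, st_in_pair2, Ht|].
      eapply within_mono, H; auto using subformula.
  - destruct (Hsub f_proj1 _ _ _ d _ IHd I Hn) as [Hc _].
    eapply covered_sub; [exact Hc | auto using subformula].
  - destruct (Hsub f_proj1 _ _ _ d _ IHd I Hn) as [Hc H].
    eapply within_mono, H; auto.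
  - destruct (Hsub f_proj2 _ _ _ d _ IHd I Hn) as [Hc _].
    eapply covered_sub; [exact Hc | auto using subformula].
  - destruct (Hsub f_proj2 _ _ _ d _ IHd I Hn) as [Hc H].
    eapply within_mono, H; auto.
  - destruct IHd as [_ H].
    { eapply normal_lam; [eassumption | exact (deriv_lc _ _ _ _ d) | exact Hn]. }
    eapply within_mono, H; [auto using subformula|].
    (* The bound variable has the domain of the arrow as its type, a subformula of the type of the
       abstraction. *)
    intros D HD; destruct (covered_hyp _ _ nil _ _ _ HD); auto using subformula.
  - destruct (Hsub (f_app u) _ _ _ d1 _ IHd1 I Hn) as [Hc _].
    eapply covered_sub; [exact Hc | auto using subformula].
  - destruct (Hsub (f_app u) _ _ _ d1 _ IHd1 I Hn) as [Hc H1].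
    destruct IHd2 as [_ H2]; [intros t' Ht; eapply Hn, st_in_app2, Ht|].
    apply Forall_app; split; [eapply within_mono, H1 | eapply within_mono, H2]; auto.
    (* The argument type is the domain of the function type, which the context covers. *)
    right; eapply covered_sub; [exact Hc | auto using subformula].
  - destruct IHd as [_ H]; [intros t' Ht; eapply Hn, st_in_inl, Ht|].
    eapply within_mono, H; auto using subformula.
  - destruct IHd as [_ H]; [intros t' Ht; eapply Hn, st_in_inr, Ht|].
    eapply within_mono, H; auto using subformula.
  - destruct (Hsub (f_case t u) _ _ _ d1 _ IHd1 I Hn) as [Hc H1].
    destruct IHd2 as [_ H2].
    { eapply normal_case1; [eassumption | exact (deriv_lc _ _ _ _ d2) | exact Hn]. }
    destruct IHd3 as [_ H3].
    { eapply normal_case2; [eassumption | exact (deriv_lc _ _ _ _ d3) | exact Hn]. }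
    (* The scrutinee is typed in [Γ] alone. Moved to the full context, coverage of its sum type
       extends to both summands, the types of the variables bound in the branches. *)
    apply (covered_app_r _ _ Γ') in Hc.
    rewrite !Forall_app; repeat split.
    + eapply within_mono, H1; auto using covered_app_r.
    + eapply within_mono, H2; [left; constructor|].
      intros D HD; destruct (covered_hyp _ _ _ _ _ _ HD) as [HA|]; [right|auto].
      eapply covered_sub; [exact Hc | auto using subformula].
    + eapply within_mono, H3; [left; constructor|].
      intros D HD; destruct (covered_hyp _ _ _ _ _ _ HD) as [HB|]; [right|auto].
      eapply covered_sub; [exact Hc | auto using subformula].
  - destruct (Hsub f_abort _ _ _ d0 _ IHd I Hn) as [Hc H].
    eapply within_mono, H; auto using covered_app_r.
  - destruct IHd as [_ H]; [intros t' Ht; eapply Hn, st_in_shut, Ht|].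
    eapply within_mono, H; [auto using subformula|].
    intros D HD; right; now apply covered_lock.
  - destruct (Hsub f_open _ _ _ d0 _ IHd I Hn) as [Hc _].
    apply covered_app_r, covered_lock.
    eapply covered_sub; [exact Hc | auto using subformula].
  - destruct (Hsub f_open _ _ _ d0 _ IHd I Hn) as [Hc H].
    eapply within_mono, H; [right | intros D HD; right];
      now apply covered_app_r, covered_lock.
Qed.

Theorem theorem5 (P : Type) (Γ : ctx P) (t : tm) (A : ty P) (d : deriv Γ t A)
    (Hnormal : normal t) (s : tm) (B : ty P)
    (Hs : In (s, B) (typed_subterms d)) :
  subformula B A \/
  exists (x : nat) (C : ty P), In (hyp x C) Γ /\ subformula B C.
Proof.
  destruct (normal_deriv_within _ _ _ _ d Hnormal) as [_ H].
  exact (proj1 (Forall_forall _ _) H _ Hs).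
Qed.
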